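(* Let $n\ge1$, $\sigma_1,\sigma_2>0$, $L>0$, and let $x_1^*\ne x_2^*$ be points of $\mathbb{R}^n$. With the sets $\mathcal M,\hat{\mathcal M},\mathcal H$ defined in the context, $$\mathcal M(x_1^*,x_2^* )\subseteq\hat{\mathcal M}(x_1^*,x_2^* )\subseteq\mathcal H(x_1^*,x_2^* )\quad\text{and}\quad \mathcal H(x_1^*,x_2^* )=\bar{\mathcal B}_{L/\sigma_1}(x_1^* )\cap\bar{\mathcal B}_{L/\sigma_2}(x_2^* ).$$
   Context: $\|\cdot\|$ is the Euclidean norm, $\bar{\mathcal B}_\rho(x_0)=\{x\in\mathbb{R}^n:\|x-x_0\|\le\rho\}$, and $\angle(u,v)=\arccos\big(\frac{u^Tv}{\|u\|\|v\|}\big)$ for nonzero $u,v$. A differentiable $f:\mathbb{R}^n\to\mathbb{R}$ is $\sigma$-strongly convex ($\sigma>0$) if $(\nabla f(x)-\nabla f(y))^T(x-y)\ge\sigma\|x-y\|^2$ for all $x,y$; $\mathcal S(\sigma)$ is the set of all such functions. $\mathcal M(x_1^*,x_2^* )$ is the set of $x\in\mathbb{R}^n$ for which there exist $f_1\in\mathcal S(\sigma_1)$, $f_2\in\mathcal S(\sigma_2)$ with $\nabla f_1(x_1^* )=0$, $\nabla f_2(x_2^* )=0$, $\nabla f_1(x)=-\nabla f_2(x)$ and $\|\nabla f_1(x)\|=\|\nabla f_2(x)\|\le L$. $\mathcal H(x_1^*,x_2^* )$ is the set of $x\in\mathbb{R}^n$ for which there exist $f_1\in\mathcal S(\sigma_1)$,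 $f_2\in\mathcal S(\sigma_2)$ with $\nabla f_1(x_1^* )=0$, $\nabla f_2(x_2^* )=0$, $\|\nabla f_1(x)\|\le L$ and $\|\nabla f_2(x)\|\le L$. For $i\in\{1,2\}$ and $x$ with $\frac{\sigma_i}L\|x-x_i^*\|\le1$ put $\tilde\phi_i(x)=\arccos\big(\frac{\sigma_i}L\|x-x_i^*\|\big)$; for $x\notin\{x_1^*,x_2^*\}$ put $\alpha_i(x)=\angle(x-x_i^*,x_2^*-x_1^* )$ and $\psi(x)=\pi-(\alpha_2(x)-\alpha_1(x))$. Define $$\hat{\mathcal M}(x_1^*,x_2^* )=\Big\{x\in\mathbb{R}^n:\ \tilde\phi_1(x)+\tilde\phi_2(x)\ge\psi(x),\ \|x-x_1^*\|\le\tfrac L{\sigma_1},\ \|x-x_2^*\|\le\tfrac L{\sigma_2}\Big\},$$ where the points $x_1^*,x_2^*$, at which $\psi$ is undefined, are regarded as not belonging to $\hat{\mathcal M}$. *)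

(* Defs.v *)
From mathcomp Require Import all_boot all_order all_algebra.
From mathcomp Require Import all_classical all_reals all_analysis.

Set Implicit Arguments.
Unset Strict Implicit.
Unset Printing Implicit Defensive.

Import Order.TTheory GRing.Theory Num.Theory.
Import numFieldNormedType.Exports.

Local Open Scope classical_set_scope.
Local Open Scope ring_scope.

(* R^n is 'rV[R]_n.  The library norm `|x| on matrices is the sup norm, so the
   Euclidean norm is defined separately; differentiability of functions on
   'rV[R]_n is the same for both norms. *)

Definition dot (R : realType) (n : nat) (u v : 'rV[R]_n) : R :=
  (u *m v^T) 0 0.

Definition enorm (R : realType) (n : nat) (u : 'rV[R]_n) : R :=
  Num.sqrt (dot u u).

Definition eball (R : realType) (n : nat) (x0 : 'rV[R]_n) (rho : R) :
    set 'rV[R]_n :=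
  [set x | enorm (x - x0) <= rho].

(* Only meaningful for nonzero u and v. *)
Definition angle (R : realType) (n : nat) (u v : 'rV[R]_n) : R :=
  acos (dot u v / (enorm u * enorm v)).

Definition grad (R : realType) (n : nat) (f : 'rV[R]_n -> R) (x : 'rV[R]_n) :
    'rV[R]_n :=
  \row_(i < n) 'D_(delta_mx 0 i) f x.

Definition strongly_convex (R : realType) (n : nat) (sigma : R) :
    set ('rV[R]_n -> R) :=
  [set f | (forall x, differentiable f x) /\
           (forall x y, sigma * enorm (x - y) ^+ 2
                        <= dot (grad f x - grad f y) (x - y))].

Definition Mset (R : realType) (n : nat) (sigma1 sigma2 L : R)
    (x1 x2 : 'rV[R]_n) : set 'rV[R]_n :=
  [set x | exists f1 f2 : 'rV[R]_n -> R,
    [/\ strongly_convex sigma1 f1 /\ strongly_convex sigma2 f2,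
        grad f1 x1 = 0,
        grad f2 x2 = 0,
        grad f1 x = - grad f2 x &
        enorm (grad f1 x) = enorm (grad f2 x) /\ enorm (grad f2 x) <= L]].

Definition Hset (R : realType) (n : nat) (sigma1 sigma2 L : R)
    (x1 x2 : 'rV[R]_n) : set 'rV[R]_n :=
  [set x | exists f1 f2 : 'rV[R]_n -> R,
    [/\ strongly_convex sigma1 f1 /\ strongly_convex sigma2 f2,
        grad f1 x1 = 0,
        grad f2 x2 = 0,
        enorm (grad f1 x) <= L &
        enorm (grad f2 x) <= L]].

(* Only meaningful when sigma / L * enorm (x - xs) <= 1. *)
Definition phit (R : realType) (n : nat) (sigma L : R) (xs x : 'rV[R]_n) : R :=
  acos (sigma / L * enorm (x - xs)).

(* The angle alpha_i(x) is alpha x1 x2 xi x; only meaningful for x != xi. *)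
Definition alpha (R : realType) (n : nat) (x1 x2 xi x : 'rV[R]_n) : R :=
  angle (x - xi) (x2 - x1).

Definition psi (R : realType) (n : nat) (x1 x2 x : 'rV[R]_n) : R :=
  pi - (alpha x1 x2 x2 x - alpha x1 x2 x1 x).

(* psi is undefined at x1 and x2, which are therefore excluded; the two norm
   bounds place x in the domain of both phit functions. *)
Definition Mhat (R : realType) (n : nat) (sigma1 sigma2 L : R)
    (x1 x2 : 'rV[R]_n) : set 'rV[R]_n :=
  [set x | [/\ x != x1 /\ x != x2,
               psi x1 x2 x <= phit sigma1 L x1 x + phit sigma2 L x2 x,
               enorm (x - x1) <= L / sigma1 &
               enorm (x - x2) <= L / sigma2]].

(* Main.v *)
Require Import Defs.
From mathcomp Require Import all_boot all_order all_algebra.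
From mathcomp Require Import all_classical all_reals all_analysis.
From mathcomp Require Import ring lra.

Set Implicit Arguments.
Unset Strict Implicit.
Unset Printing Implicit Defensive.

Import Order.TTheory GRing.Theory Num.Theory.
Import numFieldNormedType.Exports.

Local Open Scope classical_set_scope.
Local Open Scope ring_scope.

(** The set [Hset] is easy: strong convexity together with a zero gradient at
    [c] gives [sigma * |x - c|^2 <= <grad f x, x - c>] ([strong_grad_dot]), so
    by Cauchy-Schwarz [sigma * |x - c| <= |grad f x| <= L] ([strong_grad_norm]);
    conversely, the quadratic [sigma / 2 * |x - c|^2] attains this lower bound
    at every point, so that two quadratics put every common point of the balls
    into [Hset].  The second inclusion follows because the points of [Mhat] lie
    in both balls.

    For the first inclusion put [u := x - x1], [v := x - x2], [d := x2 - x1]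
    (so that [d + v = u]) and [g := grad f1 x = - grad f2 x].  The inequality
    [sigma * |x - c|^2 <= <grad f x, x - c>] also says that a gradient of norm
    at most [L] makes an angle of at most [acos (sigma / L * |x - c|)] with
    [x - c] ([strong_grad_angle]); thus [angle u g <= phit x1] and
    [angle g (- v) <= phit x2], and the triangle inequality for angles
    ([angle_triangle]) bounds [angle u (- v) = pi - angle u v] by the sum of
    the two.  It remains to see that [psi <= pi - angle u v].  This is the
    exterior angle theorem for the triangle [x1, x2, x]: the exterior angle at
    [x2] is at least the sum of the interior angles at [x1] and [x]
    ([angle_exterior]).

    Both facts about angles come from one computation.  If [e] is a unit
    vector, then [<a, b> = <a, e> <e, b> + <p, q>], where [p] and [q] are the
    components of [a] and [b] orthogonal to [e]; for unit [a] and [b] this is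
    to be compared with the addition formula for the cosine, in which
    [- |p| |q|] stands for [<p, q>].  Cauchy-Schwarz gives one comparison in
    general, and when [e] is a positive combination of [a] and [b], the
    vectors [p] and [q] are opposite and equality holds. *)

(** * The Euclidean inner product *)

Section Dot.
Variables (R : realType) (n : nat).
Implicit Types (u v w : 'rV[R]_n) (a : R).

Lemma dotE u v : dot u v = \sum_i u 0 i * v 0 i.
Proof. by rewrite /dot mxE; apply: eq_bigr => i _; rewrite mxE. Qed.

Lemma dotC u v : dot u v = dot v u.
Proof. by rewrite !dotE; apply: eq_bigr => i _; rewrite mulrC. Qed.

Lemma dotDl u v w : dot (u + v) w = dot u w + dot v w.
Proof. by rewrite /dot mulmxDl mxE. Qed.

Lemma dotZl a u v : dot (a *: u) v = a * dot u v.
Proof. by rewrite /dot -scalemxAl mxE. Qed.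

Lemma dotDr u v w : dot u (v + w) = dot u v + dot u w.
Proof. by rewrite dotC dotDl !(dotC u). Qed.

Lemma dotZr a u v : dot u (a *: v) = a * dot u v.
Proof. by rewrite dotC dotZl dotC. Qed.

Lemma dotNl u v : dot (- u) v = - dot u v.
Proof. by rewrite -scaleN1r dotZl mulN1r. Qed.

Lemma dotNr u v : dot u (- v) = - dot u v.
Proof. by rewrite dotC dotNl dotC. Qed.

Definition dotL := (dotDl, dotDr, dotNl, dotNr, dotZl, dotZr).

Lemma dot0l v : dot 0 v = 0.
Proof. by rewrite -(scale0r 0) dotZl mul0r. Qed.

Lemma dot_ge0 u : 0 <= dot u u.
Proof. by rewrite dotE sumr_ge0// => i _; rewrite -expr2 sqr_ge0. Qed.

Lemma dot_eq0 u : (dot u u == 0) = (u == 0).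
Proof.
apply/idP/eqP => [|->]; last by rewrite dot0l.
rewrite dotE psumr_eq0 => [/allP h|i _]; last by rewrite -expr2 sqr_ge0.
apply/rowP => i; rewrite mxE; apply/eqP.
by have := h i (mem_index_enum i); rewrite /= mulf_eq0 orbb.
Qed.

Lemma sqr_enorm u : enorm u ^+ 2 = dot u u.
Proof. by rewrite sqr_sqrtr// dot_ge0. Qed.

Lemma enorm_ge0 u : 0 <= enorm u.
Proof. exact: sqrtr_ge0. Qed.

Lemma enorm_eq0 u : (enorm u == 0) = (u == 0).
Proof. by rewrite -sqrf_eq0 sqr_enorm dot_eq0. Qed.

Lemma enorm_gt0 u : (0 < enorm u) = (u != 0).
Proof. by rewrite lt_def enorm_ge0 andbT enorm_eq0. Qed.

Lemma enormZ a u : enorm (a *: u) = `|a| * enorm u.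
Proof.
by rewrite /enorm dotZl dotZr mulrA -expr2 sqrtrM ?sqr_ge0// sqrtr_sqr.
Qed.

Lemma enormN u : enorm (- u) = enorm u.
Proof. by rewrite -scaleN1r enormZ normrN normr1 mul1r. Qed.

(** The expansion of [|b *: u - a *: v| ^ 2 >= 0] with [a = |u|] and
    [b = |v|]. *)
Lemma cauchy_schwarz u v : dot u v <= enorm u * enorm v.
Proof.
have [->|u0] := eqVneq u 0; first by rewrite dot0l mulr_ge0// enorm_ge0.
have [->|v0] := eqVneq v 0; first by rewrite dotC dot0l mulr_ge0// enorm_ge0.
have /mulr_gt0 ab : 0 < enorm u by rewrite enorm_gt0.
have {}ab : 0 < enorm u * enorm v by apply: ab; rewrite enorm_gt0.
have := dot_ge0 (enorm v *: u - enorm u *: v).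
rewrite !dotL -!sqr_enorm (dotC v u) => h.
rewrite -subr_ge0 -(pmulr_rge0 _ ab).
move: h; set x := dot u v; set a := enorm u; set b := enorm v; nra.
Qed.

Lemma cauchy_schwarzN u v : - (enorm u * enorm v) <= dot u v.
Proof. by rewrite lerNl -dotNl -(enormN u) cauchy_schwarz. Qed.

End Dot.

(** * Sums of arc cosines *)

Section Acos.
Context {R : realType}.
Implicit Types a b c : R.

Lemma acos_in_0pi a : -1 <= a <= 1 -> acos a \in `[0, pi].
Proof. by move=> h; rewrite in_itv/= acos_ge0 ?acos_lepi. Qed.

Lemma ler_cos_0pi a b : a \in `[0, pi] -> b \in `[0, pi] ->
  (cos a <= cos b) = (b <= a).
Proof. by move=> ha hb; rewrite !leNgt ltr_cos. Qed.

Lemma ler_acos a b : -1 <= a -> a <= b -> b <= 1 -> acos b <= acos a.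
Proof.
move=> a1 ab b1; have ha : -1 <= a <= 1 by rewrite a1 (le_trans ab).
have hb : -1 <= b <= 1 by rewrite b1 (le_trans a1).
by rewrite -ler_cos_0pi ?acos_in_0pi// !acosK.
Qed.

Lemma cos_acosD a b : -1 <= a <= 1 -> -1 <= b <= 1 ->
  cos (acos a + acos b) = a * b - Num.sqrt (1 - a ^+ 2) * Num.sqrt (1 - b ^+ 2).
Proof. by move=> ha hb; rewrite cosD !acosK// !sin_acos. Qed.

Lemma acos_le_add a b c : -1 <= a <= 1 -> -1 <= b <= 1 -> -1 <= c <= 1 ->
  a * b - Num.sqrt (1 - a ^+ 2) * Num.sqrt (1 - b ^+ 2) <= c ->
  acos c <= acos a + acos b.
Proof.
move=> ha hb hc; rewrite -cos_acosD// => h.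
(* Beyond [pi] the cosine is no longer decreasing, but [acos c <= pi]. *)
have [hpi|hpi] := leP pi (acos a + acos b).
  by rewrite (le_trans _ hpi)// acos_lepi.
rewrite -ler_cos_0pi ?acos_in_0pi// ?acosK//.
by rewrite in_itv/= addr_ge0 ?acos_ge0// ltW.
Qed.

(** The hypothesis [0 <= a + b] keeps [acos a + acos b] between [0] and [pi],
    where the cosine is decreasing. *)
Lemma add_le_acos a b c : -1 <= a <= 1 -> -1 <= b <= 1 -> -1 <= c <= 1 ->
  0 <= a + b ->
  c <= a * b - Num.sqrt (1 - a ^+ 2) * Num.sqrt (1 - b ^+ 2) ->
  acos a + acos b <= acos c.
Proof.
move=> ha hb hc ab0; rewrite -cos_acosD// => h.
have hpi : acos a + acos b <= pi.
  rewrite -lerBrDr -acosN//; apply: ler_acos.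
  - by case/andP: hb => _ hb; rewrite lerN2.
  - by rewrite -subr_ge0 opprK.
  - by case/andP: ha.
rewrite -ler_cos_0pi ?acos_in_0pi// ?acosK//.
by rewrite in_itv/= hpi addr_ge0 ?acos_ge0.
Qed.

End Acos.

(** * Angles between vectors *)

Section Angle.
Context {R : realType} {n : nat}.
Implicit Types (u v w d e : 'rV[R]_n).

Definition normalize u : 'rV[R]_n := (enorm u)^-1 *: u.

Lemma normalizeK u : u != 0 -> enorm u *: normalize u = u.
Proof. by move=> u0; rewrite scalerA divff ?scale1r// enorm_eq0. Qed.

Lemma dot_normalize u : u != 0 -> dot (normalize u) (normalize u) = 1.
Proof.
move=> u0; rewrite !dotL -sqr_enorm expr2 mulKf ?mulVf//; by rewrite enorm_eq0.
Qed.

Lemma angleE u v : angle u v = acos (dot (normalize u) (normalize v)).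
Proof. by rewrite /angle !dotL invfM; congr acos; ring. Qed.

Lemma angleC u v : angle u v = angle v u.
Proof. by rewrite !angleE dotC. Qed.

Lemma unit_dot_bounds u v : dot u u = 1 -> dot v v = 1 -> -1 <= dot u v <= 1.
Proof.
move=> hu hv; have := cauchy_schwarz u v; have := cauchy_schwarzN u v.
by rewrite /enorm hu hv sqrtr1 mulr1 => -> ->.
Qed.

Lemma angleNr u v : u != 0 -> v != 0 -> angle u (- v) = pi - angle u v.
Proof.
move=> u0 v0; rewrite !angleE -acosN ?unit_dot_bounds ?dot_normalize//.
by rewrite /normalize enormN scalerN dotNr.
Qed.

Lemma angleNN u v : angle (- u) (- v) = angle u v.
Proof. by rewrite /angle !enormN dotNl dotNr opprK. Qed.

(** The component of [w] orthogonal to the unit vector [e]. *)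
Definition rejection e w : 'rV[R]_n := w - dot w e *: e.

Lemma dot_rejection e u v : dot e e = 1 ->
  dot (rejection e u) (rejection e v) = dot u v - dot u e * dot e v.
Proof. by move=> he; rewrite !dotL he (dotC v e); ring. Qed.

Lemma enorm_rejection e u : dot e e = 1 -> dot u u = 1 ->
  enorm (rejection e u) = Num.sqrt (1 - dot u e ^+ 2).
Proof.
by move=> he hu; rewrite /enorm dot_rejection// hu (dotC e u) expr2.
Qed.

Lemma angle_triangle u v w : u != 0 -> v != 0 -> w != 0 ->
  angle u w <= angle u v + angle v w.
Proof.
move=> /dot_normalize hu /dot_normalize hv /dot_normalize hw.
rewrite !angleE; apply: acos_le_add; rewrite ?unit_dot_bounds//.
rewrite -enorm_rejection// (dotC (normalize v)) -enorm_rejection//.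
(* The two square roots are now norms of rejections from [v]. *)
have := cauchy_schwarzN (rejection (normalize v) (normalize u))
                        (rejection (normalize v) (normalize w)).
by rewrite dot_rejection// (dotC (normalize v)); lra.
Qed.

(** The exterior angle theorem, for the triangle with side vectors [d], [v]
    and [d + v].  Relative to the direction of [d + v] the orthogonal
    components of [d] and [v] cancel out, so those of the corresponding unit
    vectors are antiparallel. *)
Lemma angle_exterior d v : d != 0 -> v != 0 -> d + v != 0 ->
  angle d (d + v) + angle (d + v) v <= angle d v.
Proof.
move=> d0 v0 u0; have hd := dot_normalize d0; have hv := dot_normalize v0.
have he := dot_normalize u0.
have a0 : 0 < enorm d by rewrite enorm_gt0.
have b0 : 0 < enorm v by rewrite enorm_gt0.
have c0 : 0 < enorm (d + v) by rewrite enorm_gt0.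
have : enorm (d + v) *: normalize (d + v) =
    enorm d *: normalize d + enorm v *: normalize v by rewrite !normalizeK.
rewrite !angleE; move: a0 b0 c0 hd hv he; set a := enorm d; set b := enorm v.
set c := enorm (d + v); set dd := normalize d; set vv := normalize v.
set e := normalize _ => a0 b0 c0 hd hv he ce.
clearbody a b c dd vv e.
apply: add_le_acos; rewrite ?unit_dot_bounds//.
(* Multiplied by [c], the sum of the two cosines is
   [<a dd + b vv, dd + vv> = (a + b) (1 + <dd, vv>)]. *)
- rewrite -(pmulr_rge0 _ c0) (dotC dd) mulrDr -!dotZl ce.
  rewrite !dotL hd hv (dotC vv).
  have /andP[h _] := unit_dot_bounds hd hv.
  have -> : a * 1 + b * dot dd vv + (a * dot dd vv + b * 1) =
            (a + b) * (1 + dot dd vv) by ring.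
  by apply: mulr_ge0; lra.
- have hrej : rejection e vv = (- (a / b)) *: rejection e dd.
    have h : a *: rejection e dd + b *: rejection e vv = 0.
      rewrite /rejection !scalerBr addrACA -ce -opprD !scalerA -scalerDl.
      by rewrite -!dotZl -dotDl -ce dotZl he mulr1 subrr.
    apply: (@scalerI _ _ b); first by rewrite gt_eqF.
    rewrite scalerA mulrN mulrC divfK ?gt_eqF// scaleNr.
    by apply/eqP; rewrite -addr_eq0 addrC h.
  rewrite -enorm_rejection// (dotC e vv) -enorm_rejection// (dotC vv e).
  rewrite lerBrDl -lerBrDr -opprB -dot_rejection// hrej dotZr enormZ.
  have /ger0_norm ab : 0 <= a / b by rewrite divr_ge0 ?ltW.
  by rewrite normrN ab -sqr_enorm mulNr opprK; lra.
Qed.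

End Angle.

(** * Gradients of strongly convex functions *)

Section StrongConvexity.
Context {R : realType} {n : nat}.
Implicit Types (f : 'rV[R]_n -> R) (c x : 'rV[R]_n) (sigma L : R).

Lemma strong_grad_dot f sigma c x : strongly_convex sigma f -> grad f c = 0 ->
  sigma * enorm (x - c) ^+ 2 <= dot (grad f x) (x - c).
Proof. by move=> [_ /(_ x c)] + fc; rewrite fc subr0. Qed.

Lemma strong_grad_norm f sigma c x : strongly_convex sigma f -> grad f c = 0 ->
  sigma * enorm (x - c) <= enorm (grad f x).
Proof.
move=> fs fc; have [->|xc] := eqVneq x c.
  by rewrite subrr /enorm dot0l sqrtr0 mulr0 sqrtr_ge0.
have r0 : 0 < enorm (x - c) by rewrite enorm_gt0 subr_eq0.
rewrite -(ler_pM2r r0) -mulrA -expr2.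
exact: le_trans (strong_grad_dot _ fs fc) (cauchy_schwarz _ _).
Qed.

Lemma strong_grad_neq0 f sigma c x : 0 < sigma -> strongly_convex sigma f ->
  grad f c = 0 -> x != c -> grad f x != 0.
Proof.
move=> s0 fs fc xc; rewrite -enorm_gt0.
apply: lt_le_trans (strong_grad_norm _ fs fc).
by rewrite mulr_gt0// enorm_gt0 subr_eq0.
Qed.

Lemma strong_grad_ball f sigma L c x : 0 < sigma -> strongly_convex sigma f ->
  grad f c = 0 -> enorm (grad f x) <= L -> enorm (x - c) <= L / sigma.
Proof.
move=> s0 fs fc gL; rewrite ler_pdivlMr// mulrC.
exact: le_trans (strong_grad_norm _ fs fc) gL.
Qed.

(** The cosine of this angle is at least [sigma * |x - c| / |grad f x|], by
    [strong_grad_dot]; enlarging [|grad f x|] to [L] only decreases it. *)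
Lemma strong_grad_angle f sigma L c x : 0 < sigma -> 0 < L ->
  strongly_convex sigma f -> grad f c = 0 -> x != c -> enorm (grad f x) <= L ->
  angle (grad f x) (x - c) <= phit sigma L c x.
Proof.
move=> s0 L0 fs fc xc gL.
have u0 : x - c != 0 by rewrite subr_eq0.
have r0 : 0 < enorm (x - c) by rewrite enorm_gt0.
have g0 : grad f x != 0 by apply: strong_grad_neq0 fs fc xc.
have k0 : 0 < enorm (grad f x) by rewrite enorm_gt0.
apply: ler_acos.
- rewrite (@le_trans _ _ 0) ?lerN10//.
  by rewrite !mulr_ge0 ?invr_ge0 ?enorm_ge0 ?ltW.
- apply: (@le_trans _ _ (sigma / enorm (grad f x) * enorm (x - c))).
    by rewrite ler_pM2r// ler_pM2l// lef_pV2.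
  rewrite ler_pdivlMr ?mulr_gt0//.
  apply: le_trans (strong_grad_dot _ fs fc); rewrite le_eqVlt; apply/orP; left.
  by apply/eqP; field; rewrite gt_eqF.
- by rewrite ler_pdivrMr ?mulr_gt0// mul1r cauchy_schwarz.
Qed.

(** * Quadratic functions *)

Definition quadratic sigma c x := sigma / 2 * enorm (x - c) ^+ 2.

Lemma quadraticE sigma c : quadratic sigma c =
  (sigma / 2) \*: \sum_(i < n) (fun x => x 0 i - c 0 i) ^+ 2.
Proof.
apply/funext => x; rewrite /quadratic sqr_enorm dotE /= fct_sumE.
by congr (_ * _); apply: eq_bigr => i _; rewrite !mxE.
Qed.

Lemma differentiable_quadratic sigma c x : differentiable (quadratic sigma c) x.
Proof.
rewrite quadraticE; apply: differentiableZ; apply: differentiable_sum => i.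
apply: differentiableX; apply: differentiableB => //.
exact: differentiable_coord.
Qed.

Lemma is_derive_coord x v (i : 'I_n) :
  is_derive x v (fun y : 'rV[R]_n => y 0 i) (v 0 i).
Proof.
have @f : {linear 'rV[R]_n -> R}.
  by exists (fun y : 'rV[R]_n => y 0 i); do 2![eexists]; do ?[constructor];
     rewrite ?mxE// => ? *; rewrite ?mxE//; move=> ?; rewrite !mxE.
apply: DeriveDef; first exact/diff_derivable/differentiable_coord.
rewrite deriveE; last exact: differentiable_coord.
rewrite (_ : (fun _ => _) = f)// diff_lin//; exact: coord_continuous.
Qed.

Lemma grad_quadratic sigma c x : grad (quadratic sigma c) x = sigma *: (x - c).
Proof.
apply/rowP => i; rewrite !mxE quadraticE.
have h (j : 'I_n) : is_derive x (delta_mx 0 i)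
    (fun y : 'rV[R]_n => y 0 j - c 0 j) ((delta_mx 0 i : 'rV[R]_n) 0 j - 0).
  exact: (is_deriveB (is_derive_coord x _ j) (is_derive_cst (c 0 j) x _)).
rewrite derive_val (bigD1 i)//= big1 => [|j ji]; last first.
  by rewrite mxE (negbTE ji) subr0 scaler0.
by rewrite mxE !eqxx subr0 addr0 /GRing.scale /=; field.
Qed.

Lemma quadratic_strongly_convex sigma c :
  strongly_convex sigma (quadratic sigma c).
Proof.
split=> [x|x y]; first exact: differentiable_quadratic.
by rewrite !grad_quadratic -scalerBr opprB addrA subrK dotZl sqr_enorm.
Qed.

Lemma grad_quadratic_center sigma c : grad (quadratic sigma c) c = 0.
Proof. by rewrite grad_quadratic subrr scaler0. Qed.

Lemma grad_quadratic_ball sigma L c x : 0 < sigma ->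
  enorm (x - c) <= L / sigma ->
  enorm (grad (quadratic sigma c) x) <= L.
Proof.
move=> s0 xc; rewrite grad_quadratic enormZ gtr0_norm// mulrC.
by rewrite -ler_pdivlMr.
Qed.

End StrongConvexity.

(** * The inclusions *)

Section Inclusions.
Context {R : realType} {n : nat}.
Variables (sigma1 sigma2 L : R) (x1 x2 : 'rV[R]_n).
Hypotheses (hsigma1 : 0 < sigma1) (hsigma2 : 0 < sigma2).

Lemma HsetE : Hset sigma1 sigma2 L x1 x2 =
  eball x1 (L / sigma1) `&` eball x2 (L / sigma2).
Proof.
apply/seteqP; split=> x.
  by move=> [f1 [f2 [[s1 s2] c1 c2 g1 g2]]]; split;
    [apply: strong_grad_ball s1 c1 g1|apply: strong_grad_ball s2 c2 g2].
move=> [b1 b2]; exists (quadratic sigma1 x1), (quadratic sigma2 x2); split.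
- by split; exact: quadratic_strongly_convex.
- exact: grad_quadratic_center.
- exact: grad_quadratic_center.
- exact: grad_quadratic_ball.
- exact: grad_quadratic_ball.
Qed.

Lemma Mset_sub_Mhat : 0 < L -> x1 != x2 ->
  Mset sigma1 sigma2 L x1 x2 `<=` Mhat sigma1 sigma2 L x1 x2.
Proof.
move=> L0 x12 x [f1 [f2 [[s1 s2] c1 c2 g12 [g1E g2L]]]].
have g1L : enorm (grad f1 x) <= L by rewrite g1E.
(* If [x] were one of the minimizers, both gradients would vanish at [x], so
   that [x] would be the other minimizer as well. *)
have xx1 : x != x1.
  apply: contraTneq x12 => xE; rewrite negbK; apply: contraT => x12.
  have := strong_grad_neq0 hsigma2 s2 c2 x12.
  by rewrite -oppr_eq0 -xE -g12 xE c1 eqxx.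
have xx2 : x != x2.
  apply: contraTneq x12 => xE; rewrite negbK eq_sym; apply: contraT => x21.
  have := strong_grad_neq0 hsigma1 s1 c1 x21.
  by rewrite -xE g12 oppr_eq0 xE c2 eqxx.
have u0 : x - x1 != 0 by rewrite subr_eq0.
have v0 : x - x2 != 0 by rewrite subr_eq0.
have d0 : x2 - x1 != 0 by rewrite subr_eq0 eq_sym.
have uE : x2 - x1 + (x - x2) = x - x1 by rewrite addrC addrA subrK.
split; first by [].
- have g0 := strong_grad_neq0 hsigma1 s1 c1 xx1.
  have a1 := strong_grad_angle hsigma1 L0 s1 c1 xx1 g1L.
  have a2 := strong_grad_angle hsigma2 L0 s2 c2 xx2 g2L.
  have vN0 : - (x - x2) != 0 by rewrite oppr_eq0.
  have tri := angle_triangle u0 g0 vN0.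
  rewrite angleNr// (angleC _ (grad f1 x)) {2}g12 angleNN in tri.
  have ext : angle (x2 - x1) (x - x1) + angle (x - x1) (x - x2) <=
      angle (x2 - x1) (x - x2).
    by rewrite -uE; apply: angle_exterior; rewrite ?uE.
  rewrite /psi /alpha (angleC (x - x2)) (angleC (x - x1)).
  lra.
- exact: strong_grad_ball s1 c1 g1L.
- exact: strong_grad_ball s2 c2 g2L.
Qed.

End Inclusions.

Theorem lemma2 (R : realType) (n : nat) (sigma1 sigma2 L : R)
    (x1 x2 : 'rV[R]_n) (hn : (1 <= n)%N)
    (hsigma1 : 0 < sigma1) (hsigma2 : 0 < sigma2) (hL : 0 < L)
    (hx : x1 <> x2) :
  (Mset sigma1 sigma2 L x1 x2 `<=` Mhat sigma1 sigma2 L x1 x2 /\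
   Mhat sigma1 sigma2 L x1 x2 `<=` Hset sigma1 sigma2 L x1 x2) /\
  Hset sigma1 sigma2 L x1 x2 =
    eball x1 (L / sigma1) `&` eball x2 (L / sigma2).
Proof.
split; last exact: HsetE.
split; first by apply: Mset_sub_Mhat => //; exact/eqP.
by rewrite HsetE// => x [_ _ b1 b2].
Qed.
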